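(* Let $m\ge 1$ be an integer, let $n,p\ge 1$ be integers, and let $n_1,n_2,r_1,r_2\ge 0$ be integers with $n=n_1+n_2$ and $p=r_1+r_2$. Let $$\alpha_1\ge\alpha_2\ge\dots\ge\alpha_n,\qquad \beta_1\ge\beta_2\ge\dots\ge\beta_p$$ be real numbers in $(0,1)$ with $\alpha_1=\beta_1$. Suppose that $$\sum_{j=1}^{r_1}\Big(\frac{1+\beta_j}{2}\Big)^{m-1}\Big(\frac{1-\beta_j}{2}\Big)^2>\frac{3\beta_1-1}{1+\beta_1},\qquad \sum_{j=r_1+1}^{r_1+r_2}\Big(\frac{1+\beta_j}{2}\Big)^{m-1}\Big(\frac{1-\beta_j}{2}\Big)>1,$$ and $$\sum_{j=1}^{n_1}\Big(\frac{1+\alpha_j}{2}\Big)^{m-1}\Big(\frac{1-\alpha_j}{2}\Big)^2>\frac{3\alpha_1-1}{1+\alpha_1},\qquad \sum_{j=n_1+1}^{n_1+n_2}\Big(\frac{1+\alpha_j}{2}\Big)^{m-1}\Big(\frac{1-\alpha_j}{2}\Big)>1.$$ Then the interval $$\left[\sum_{i=2}^{n}\Big(\frac{1+\alpha_i}{2}\Big)^m+p-1+2\Big(\frac{1+\beta_1}{2}\Big)^m,\ \sum_{i=2}^{n}\Big(\frac{1+\alpha_i}{2}\Big)^m+(p+1)\right]$$ is contained in the set $$\Gamma=\left\{\sum_{i=1}^{n}c_i^m+\sum_{i=1}^{p}d_i^m : c_i\in C_{\alpha_i},\ d_i\in C_{\beta_i}\right\},$$ where $C_\gamma$ denotes the central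 Cantor set with parameter $\gamma$.
   Context: For $\alpha\in(0,1)$ the central Cantor set is $C_\alpha=\bigcap_{l\ge 1}C_l$, where $C_0=[0,1]$ and, for $l\ge 1$, $C_l$ is obtained from $C_{l-1}$ (a disjoint union of $2^{l-1}$ closed intervals of equal length) by removing from each of these closed intervals the open interval with the same centre and with length $\alpha$ times the length of that closed interval. Thus $C_1=[0,\frac{1-\alpha}{2}]\cup[\frac{1+\alpha}{2},1]$, and $C_l$ is a union of $2^l$ closed intervals of length $\left(\frac{1-\alpha}{2}\right)^l$. Empty sums are $0$. *)

(* Defs.v *)
From HB Require Import structures.
From mathcomp Require Import all_boot all_order all_algebra.
From mathcomp Require Import all_classical all_reals.
From mathcomp Require Import lra.

Set Implicit Arguments.
Unset Strict Implicit.
Unset Printing Implicit Defensive.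

Import Order.TTheory GRing.Theory Num.Theory.

Local Open Scope classical_set_scope.
Local Open Scope ring_scope.

(* A pair [I] stands for the closed interval [I.1, I.2]. *)
Definition midpoint (R : realType) (I : R * R) : R := (I.1 + I.2) / 2.

Definition half_gap (R : realType) (alpha : R) (I : R * R) : R :=
  alpha * (I.2 - I.1) / 2.

(* The two closed intervals that remain of [I] once the concentric open interval of
   length alpha * (I.2 - I.1) is removed, see [remove_middleE]. *)
Definition remove_middle (R : realType) (alpha : R) (I : R * R) : seq (R * R) :=
  [:: (I.1, midpoint I - half_gap alpha I);
      (midpoint I + half_gap alpha I, I.2)].

Fixpoint cantor_intervals (R : realType) (alpha : R) (l : nat) : seq (R * R) :=
  if l is k.+1 then flatten (map (remove_middle alpha) (cantor_intervals alpha k))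
  else [:: (0, 1)].

Definition interval_union (R : realType) (s : seq (R * R)) : set R :=
  [set x | exists2 I, I \in s & x \in `[I.1, I.2]].

Definition cantor_level (R : realType) (alpha : R) (l : nat) : set R :=
  interval_union (cantor_intervals alpha l).

Definition central_cantor (R : realType) (alpha : R) : set R :=
  \bigcap_(l in [set l : nat | (1 <= l)%N]) cantor_level alpha l.

(* Families are indexed from 1; their values outside 1..n (resp. 1..p) are
   irrelevant. *)
Definition cantor_power_sums (R : realType) (m n p : nat) (alpha beta : nat -> R)
    : set R :=
  [set x | exists c d : nat -> R,
    [/\ forall i, (1 <= i <= n)%N -> central_cantor (alpha i) (c i),
        forall i, (1 <= i <= p)%N -> central_cantor (beta i) (d i) &
        x = \sum_(1 <= i < n.+1) c i ^+ m + \sum_(1 <= i < p.+1) d i ^+ m]].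

Lemma remove_middleE (R : realType) (alpha : R) (I : R * R) :
  0 < alpha < 1 -> I.1 <= I.2 ->
  interval_union (remove_middle alpha I) =
  `[I.1, I.2] `\`
  `]midpoint I - half_gap alpha I, midpoint I + half_gap alpha I[.
Proof.
case: I => a b /= /andP[a0 a1] ab; set I := (a, b).
have h0 : 0 <= half_gap alpha I.
  by rewrite /half_gap divr_ge0 // mulr_ge0 ?subr_ge0 // ltW.
have hb : half_gap alpha I <= (b - a) / 2.
  by rewrite /half_gap ler_pM2r ?invr_gt0 // ler_piMl ?subr_ge0 // ltW.
have l1 : midpoint I + half_gap alpha I <= b by rewrite /midpoint /=; lra.
have l2 : a <= midpoint I - half_gap alpha I by rewrite /midpoint /=; lra.
have l3 : midpoint I - half_gap alpha I <= midpoint I + half_gap alpha I by lra.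
apply/seteqP; split => x; rewrite /interval_union /= !in_itv /=.
  move=> [J + xJ]; rewrite !inE => /orP[] /eqP eJ;
    move: xJ; rewrite eJ in_itv /= => /andP[xa xb].
    split; first by rewrite xa (le_trans xb) // (le_trans l3).
    by apply/negP; rewrite negb_and -!leNgt xb.
  split; first by rewrite xb (le_trans _ xa) // (le_trans l2).
  by apply/negP; rewrite negb_and -!leNgt xa orbT.
move=> [/andP[xa xb] /negP]; rewrite negb_and -!leNgt => /orP[xl|xr].
  exists (a, midpoint I - half_gap alpha I); first by rewrite !inE eqxx.
  by rewrite /= in_itv /= xa xl.
exists (midpoint I + half_gap alpha I, b); first by rewrite !inE eqxx orbT.
by rewrite /= in_itv /= xb xr.
Qed.

(* Main.v *)
Require Import Defs.
From HB Require Import structures.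
From mathcomp Require Import all_boot all_order all_algebra.
From mathcomp Require Import all_classical all_reals.
From mathcomp Require Import topology normedtype sequences.
From mathcomp Require Import ring lra zify.

Set Implicit Arguments.
Unset Strict Implicit.

Import Order.TTheory GRing.Theory Num.Theory.
Import numFieldNormedType.Exports.

Local Open Scope classical_set_scope.
Local Open Scope ring_scope.

(** Write A_i = (1 + alpha_i) / 2 and f(x) = x ^ m. The point of the argument is
    that the last n2 of the sets C_(alpha_i) alone already fill an interval that
    is long enough.

    Consider finitely many sets C_(alpha_i) with
    sum_i A_i ^ (m - 1) * (1 - alpha_i) / 2 > 1, and keep only their right
    parts, contained in [A_i, 1]. Start from the intervals [A_i, 1] and split
    repeatedly the longest current interval I_i, of length s say, into its two
    children. As (1 - alpha_j) / 2 * s <= |I_j| <= s holds for all j throughout,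
    and as the slope of f / m lies between A_j ^ (m - 1) and 1 on [A_j, 1], the
    images of the other intervals have total length at least
      m * s * sum_(j <> i) A_j ^ (m - 1) * (1 - alpha_j) / 2 > m * s * alpha_i,
    because the omitted term is at most (1 - alpha_i) / 2 <= 1 - alpha_i. This
    is more than the image of the gap that the splitting opens
    ([others_cover_gap]), so that any given value that is a sum of points
    of the images stays such a sum for one of the two children
    ([refinement_step]). The total length decreases geometrically, and the
    limit of the intervals is a point of the product of the Cantor sets at
    which the given value is attained ([right_parts_fill]). Hence sums of m-th
    powers of points of these right parts fill the whole interval from
    sum_i A_i ^ m to the number of summands ([right_power_sums_fill]), whose
    length is at least m ([right_power_sums_length]).

    In the theorem, take c_i = A_i for i <= n1, d_1 = A_1 (as
    alpha_1 = beta_1), and d_i = 1 for i >= 2. With c_i = A_i for i > n1 as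
    well, the sum is the left end of the target interval, and the length of the
    target is 2 * (1 - A_1 ^ m) <= 2 * m * (1 - A_1) <= m, so the c_i with
    i > n1 reach all of it. *)

(** * Self-similarity of central Cantor sets *)

(** The central Cantor set, described with the level 0 included. This is the
    same set, in a form that is convenient when levels are shifted. *)
Definition on_all_levels {R : realType} (a : R) : set R :=
  [set x | forall l, cantor_level a l x].

Lemma on_all_levels_cantor (R : realType) (a : R) :
  on_all_levels a `<=` central_cantor a.
Proof. by move=> x xa l _; exact: xa. Qed.

Lemma cantor_intervalsSP {R : realType} (a : R) (l : nat) (K : R * R) :
  reflect (exists2 I, I \in cantor_intervals a l & K \in remove_middle a I)
          (K \in cantor_intervals a l.+1).
Proof. by apply: (iffP flatten_mapP) => -[I]; exists I. Qed.

Lemma remove_middle_affine (R : realType) (a p q : R) (I K : R * R) :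
  K \in remove_middle a I ->
  (p + q * K.1, p + q * K.2) \in remove_middle a (p + q * I.1, p + q * I.2).
Proof.
rewrite !inE => /orP[] /eqP-> /=; apply/orP; [left|right]; apply/eqP;
  rewrite /midpoint /half_gap /=; congr pair; lra.
Qed.

(** The affine map that sends [0, 1] onto an interval of level 1 sends every
    interval of level l to one of level l + 1. *)
Lemma cantor_intervals_affine (R : realType) (a p q : R) (l : nat)
    (I : R * R) :
  (p, p + q) \in cantor_intervals a 1 -> I \in cantor_intervals a l ->
  (p + q * I.1, p + q * I.2) \in cantor_intervals a l.+1.
Proof.
move=> pq; elim: l I => [|l IH] I.
  by rewrite inE => /eqP-> /=; rewrite mulr0 addr0 mulr1.
move=> /cantor_intervalsSP[K Kl IK]; apply/cantor_intervalsSP.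
by exists (p + q * K.1, p + q * K.2); [exact: IH | exact: remove_middle_affine].
Qed.

Lemma on_all_levels_affine (R : realType) (a p q x : R) :
  0 <= p -> 0 <= q -> p + q <= 1 -> (p, p + q) \in cantor_intervals a 1 ->
  on_all_levels a x -> on_all_levels a (p + q * x).
Proof.
move=> p0 q0 pq1 pq xa [|l].
  have [J] := xa 0%N; rewrite inE => /eqP->; rewrite in_itv /= => /andP[x0 x1].
  exists (0, 1); first by rewrite inE.
  by rewrite /= in_itv /=; apply/andP; split; nra.
have [I Il] := xa l; rewrite /= in_itv /= => /andP[Ix xI].
exists (p + q * I.1, p + q * I.2); first exact: cantor_intervals_affine.
by rewrite in_itv /= !lerD2l !ler_wpM2l.
Qed.

(** The ends of [0, 1] are obtained from this lemma as the fixed points of the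
    two similarities that generate the Cantor set. *)
Lemma on_all_levels_fixpoint (R : realType) (a p q x : R) :
  0 <= q -> 0 <= x <= 1 -> p + q * x = x ->
  (p, p + q) \in cantor_intervals a 1 -> on_all_levels a x.
Proof.
move=> q0 x01 fixx pq; elim=> [|l [I Il]].
  by exists (0, 1); [rewrite inE | rewrite /= in_itv].
rewrite /= in_itv /= => /andP[Ix xI].
exists (p + q * I.1, p + q * I.2); first exact: cantor_intervals_affine.
by rewrite -fixx in_itv /= !lerD2l !ler_wpM2l.
Qed.

Lemma left_interval_level1 (R : realType) (a : R) :
  (0, 0 + (1 - a) / 2) \in cantor_intervals a 1.
Proof.
rewrite !inE /midpoint /half_gap /=; apply/orP; left; apply/eqP.
by congr pair; lra.
Qed.

Lemma right_interval_level1 (R : realType) (a : R) :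
  ((1 + a) / 2, (1 + a) / 2 + (1 - a) / 2) \in cantor_intervals a 1.
Proof.
rewrite !inE /midpoint /half_gap /=; apply/orP; right; apply/eqP.
by congr pair; lra.
Qed.

Lemma on_all_levels0 (R : realType) (a : R) : 0 < a < 1 -> on_all_levels a 0.
Proof.
move=> /andP[a0 a1].
by apply: on_all_levels_fixpoint (left_interval_level1 a); lra.
Qed.

Lemma on_all_levels1 (R : realType) (a : R) : 0 < a < 1 -> on_all_levels a 1.
Proof.
move=> /andP[a0 a1].
by apply: on_all_levels_fixpoint (right_interval_level1 a); lra.
Qed.

Lemma on_all_levels_left (R : realType) (a x : R) : 0 < a < 1 ->
  on_all_levels a x -> on_all_levels a ((1 - a) / 2 * x).
Proof.
move=> /andP[a0 a1] xa; rewrite -[_ * x]add0r.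
by apply: on_all_levels_affine (left_interval_level1 a) xa; lra.
Qed.

Lemma on_all_levels_right (R : realType) (a x : R) : 0 < a < 1 ->
  on_all_levels a x -> on_all_levels a ((1 + a) / 2 + (1 - a) / 2 * x).
Proof.
move=> /andP[a0 a1] xa.
by apply: on_all_levels_affine (right_interval_level1 a) xa; lra.
Qed.

Lemma half_add_cantor (R : realType) (a : R) : 0 < a < 1 ->
  central_cantor a ((1 + a) / 2).
Proof.
move=> a01; apply: on_all_levels_cantor; rewrite -[_ / 2]addr0.
rewrite -[X in _ + X](mulr0 ((1 - a) / 2)).
exact: on_all_levels_right (on_all_levels0 a01).
Qed.

Lemma closed_interval_union (R : realType) (s : seq (R * R)) :
  closed (interval_union s).
Proof.
have -> : interval_union s = \big[setU/set0]_(I <- s) `[I.1, I.2]%classic.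
  by rewrite -bigcup_seq; apply/seteqP; split => x [I Is xI]; exists I.
by apply: closed_bigsetU => I _; exact: itv_closed.
Qed.

Lemma on_all_levels_limit (R : realType) (a x : R) (u : R^nat) :
  (forall k, on_all_levels a (u k)) -> u @ \oo --> x -> on_all_levels a x.
Proof.
move=> ua ux l.
have cl : closed (cantor_level a l) by exact: closed_interval_union.
by apply: (closed_cvg _ cl _ _ ux); apply: nearW => k; exact: ua.
Qed.

(** * Sums of images of right parts of Cantor sets *)

(** The functions [f i] replace x ^ m / m; only the bounds on their slopes on
    the interval [(1 + alpha i) / 2, 1] matter. [T] is the value to be attained. *)
Section refinement.
Variables (R : realType) (I : finType) (alpha w : I -> R) (f : I -> R -> R).
Variable T : R.
Hypothesis alpha01 : forall i, 0 < alpha i < 1.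
Hypothesis w01 : forall i, 0 <= w i <= 1.
Hypothesis f_slope : forall i x y, (1 + alpha i) / 2 <= x -> x <= y -> y <= 1 ->
  w i * (y - x) <= f i y - f i x <= y - x.
Hypothesis wide : 1 < \sum_i w i * ((1 - alpha i) / 2).

(** A state is a pair of families: the left ends and the lengths of the current
    intervals. It is admissible if the i-th interval lies in the right part of
    [0, 1] and carries a scaled copy of the i-th Cantor set, if no interval is
    too short compared with the others, and if [T] lies between the sums of the
    values at the left ends and at the right ends. *)
Definition admissible (st : (I -> R) * (I -> R)) : Prop :=
  [/\ forall i, [/\ (1 + alpha i) / 2 <= st.1 i, 0 < st.2 i
                  & st.1 i + st.2 i <= 1],
      forall i y, on_all_levels (alpha i) y ->
        on_all_levels (alpha i) (st.1 i + st.2 i * y),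
      forall i j, (1 - alpha i) / 2 * st.2 j <= st.2 i &
      \sum_i f i (st.1 i) <= T <= \sum_i f i (st.1 i + st.2 i)].

(** The gap that opens in the longest interval has an image no longer than the
    images of the other intervals together. *)
Lemma others_cover_gap (u s : I -> R) (i : I) : admissible (u, s) ->
  (forall j, s j <= s i) ->
  f i (u i + (1 + alpha i) / 2 * s i) - f i (u i + (1 - alpha i) / 2 * s i)
  <= \sum_(j | j != i) (f j (u j + s j) - f j (u j)).
Proof.
case=> /= us _ ratio _ smax.
have [ui si usi] := us i; have /andP[ai0 ai1] := alpha01 i.
have /andP[_ gap] : w i * (u i + (1 + alpha i) / 2 * s i
       - (u i + (1 - alpha i) / 2 * s i))
    <= f i (u i + (1 + alpha i) / 2 * s i)
       - f i (u i + (1 - alpha i) / 2 * s i)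
    <= u i + (1 + alpha i) / 2 * s i - (u i + (1 - alpha i) / 2 * s i).
  by apply: f_slope; nra.
apply: (le_trans gap).
apply: (@le_trans _ _ (\sum_(j | j != i) w j * ((1 - alpha j) / 2) * s i)).
  rewrite -mulr_suml.
  have := wide; rewrite (bigD1 i) //=; set S := \sum_(j | _) _ => wideS.
  have /andP[wi0 wi1] := w01 i.
  (* The omitted term is at most (1 - alpha i) / 2 <= 1 - alpha i. *)
  have : alpha i < S by nra.
  by move=> ltS; nra.
apply: ler_sum => j _; have [uj sj usj] := us j.
have /andP[le_f _] : w j * (u j + s j - u j) <= f j (u j + s j) - f j (u j)
    <= u j + s j - u j by apply: f_slope => //; lra.
apply: le_trans le_f; rewrite -mulrA; have /andP[wj0 _] := w01 j.
by apply: ler_wpM2l => //; rewrite [u j + _]addrC addrK.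
Qed.

(** The family [g] with its value at [i] replaced by [x]. *)
Definition update (g : I -> R) (i : I) (x : R) : I -> R :=
  fun j => if j == i then x else g j.

Lemma updateE (g : I -> R) (i : I) (x : R) : update g i x i = x.
Proof. by rewrite /update eqxx. Qed.

Lemma updateN (g : I -> R) (i j : I) (x : R) : j != i -> update g i x j = g j.
Proof. by rewrite /update => /negbTE->. Qed.

(** Replacing the longest interval by one of its children, with left end [v],
    keeps a state admissible if [T] remains reachable. *)
Lemma admissible_update (u s : I -> R) (i : I) (v : R) :
  admissible (u, s) -> (forall j, s j <= s i) ->
  u i <= v -> v + (1 - alpha i) / 2 * s i <= u i + s i ->
  (forall y, on_all_levels (alpha i) y ->
     on_all_levels (alpha i) (v + (1 - alpha i) / 2 * s i * y)) ->
  f i v + \sum_(j | j != i) f j (u j) <= T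
    <= f i (v + (1 - alpha i) / 2 * s i)
       + \sum_(j | j != i) f j (u j + s j) ->
  admissible (update u i v, update s i ((1 - alpha i) / 2 * s i)).
Proof.
case=> /= us lev ratio _ smax uv vs levi Tin.
have [ui si usi] := us i; have /andP[ai0 ai1] := alpha01 i.
split=> /=.
- move=> j; have [->|ji] := eqVneq j i; last by rewrite !updateN.
  by rewrite !updateE; split; nra.
- move=> j y; have [->|ji] := eqVneq j i; last first.
    by rewrite !updateN //; exact: lev.
  by rewrite !updateE; exact: levi.
- have le_s j : update s i ((1 - alpha i) / 2 * s i) j <= s i.
    have [->|ji] := eqVneq j i; first by rewrite updateE; nra.
    by rewrite updateN.
  move=> j k; have /andP[aj0 aj1] := alpha01 j.
  have a2 : 0 <= (1 - alpha j) / 2 by lra.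
  apply: (le_trans (ler_wpM2l a2 (le_s k))).
  have [->|ji] := eqVneq j i; first by rewrite updateE.
  by rewrite updateN.
- rewrite (bigD1 i) //= [X in _ <= _ <= X](bigD1 i) //= !updateE.
  rewrite (eq_bigr (fun j => f j (u j))); last by move=> j ji; rewrite updateN.
  rewrite [X in _ <= _ <= _ + X](eq_bigr (fun j => f j (u j + s j))) //.
  by move=> j ji; rewrite !updateN.
Qed.

(** [st'] is nested in [st], and its total length is smaller by a fixed
    factor. *)
Definition refines (st st' : (I -> R) * (I -> R)) : Prop :=
  [/\ forall i, st.1 i <= st'.1 i,
      forall i, st'.1 i + st'.2 i <= st.1 i + st.2 i &
      \sum_i st'.2 i <= (1 - (2 * #|I|%:R)^-1) * \sum_i st.2 i].

(** The longest interval, of length at least the average, loses more than half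
    of its length: hence the factor in [refines]. *)
Lemma refines_update (u s : I -> R) (i : I) (v : R) :
  (forall j, s j <= s i) -> 0 < s i ->
  u i <= v -> v + (1 - alpha i) / 2 * s i <= u i + s i ->
  refines (u, s) (update u i v, update s i ((1 - alpha i) / 2 * s i)).
Proof.
move=> smax si uv vs; have /andP[ai0 ai1] := alpha01 i; split=> /=.
- by move=> j; have [->|ji] := eqVneq j i; [rewrite updateE|rewrite updateN].
- by move=> j; have [->|ji] := eqVneq j i; [rewrite !updateE|rewrite !updateN].
have I0 : 0 < #|I|%:R :> R by rewrite ltr0n; apply/card_gt0P; exists i.
have sum_le : \sum_j s j <= #|I|%:R * s i.
  by rewrite mulr_natl -sumr_const; apply: ler_sum.
have half : (2 * #|I|%:R)^-1 * \sum_j s j <= s i / 2.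
  by rewrite mulrC ler_pdivrMr ?mulr_gt0 //; lra.
rewrite [leRHS]mulrBl mul1r lerBrDr; apply: (le_trans (lerD (lexx _) half)).
rewrite (bigD1 i) //= [X in _ <= X](bigD1 i) //= updateE.
rewrite (eq_bigr s); last by move=> j ji; rewrite updateN.
set S := \sum_(j | _) _.
by nra.
Qed.

Lemma refinement_step (st : (I -> R) * (I -> R)) : admissible st ->
  exists2 st', admissible st' & refines st st'.
Proof.
case: st => u s adm.
have [/= us lev ratio /andP[loT Thi]] := adm.
have [i0 _|I0] := pickP (fun _ : I => true); last first.
  by have := wide; rewrite big_pred0 ?ltr10 // => i; rewrite -(I0 i).
pose i := [arg max_(j > i0) s j]%O.
have smax j : s j <= s i by rewrite /i; case: arg_maxP => // k _; exact.
have [ui si usi] := us i; have /andP[ai0 ai1] := alpha01 i.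
have := others_cover_gap adm smax; rewrite sumrB => cover.
move: loT Thi; rewrite (bigD1 i) //= [X in _ -> _ <= X -> _](bigD1 i) //=.
move=> loT Thi.
have [TL|TR] := leP T (f i (u i + (1 - alpha i) / 2 * s i)
                        + \sum_(j | j != i) f j (u j + s j)).
  (* [T] is reachable with the left child. *)
  exists (update u i (u i), update s i ((1 - alpha i) / 2 * s i)).
    apply: admissible_update => //; first by nra.
      move=> y ya; rewrite [_ * s i]mulrC -mulrA; apply: lev.
      exact: on_all_levels_left.
    by apply/andP; split.
  by apply: refines_update => //; nra.
(* Otherwise, [T] is beyond the gap, and the right child is kept. *)
have end_eq : u i + (1 + alpha i) / 2 * s i + (1 - alpha i) / 2 * s i
    = u i + s i by lra.
exists (update u i (u i + (1 + alpha i) / 2 * s i),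
        update s i ((1 - alpha i) / 2 * s i)).
  apply: admissible_update => //; first by nra.
  - by rewrite end_eq.
  - move=> y ya; have := lev i _ (on_all_levels_right (alpha01 i) ya).
    by congr on_all_levels; ring.
  - by rewrite end_eq; apply/andP; split => //; lra.
by apply: refines_update => //; [nra|rewrite end_eq].
Qed.


Lemma admissible_start :
  \sum_i f i ((1 + alpha i) / 2) <= T <= \sum_i f i 1 ->
  admissible (fun i => (1 + alpha i) / 2, fun i => (1 - alpha i) / 2).
Proof.
move=> Tin; split=> /=.
- by move=> i; have /andP[ai0 ai1] := alpha01 i; split; lra.
- by move=> i y; exact: on_all_levels_right.
- move=> i j; have /andP[ai0 ai1] := alpha01 i.
  by have /andP[aj0 aj1] := alpha01 j; nra.
- rewrite [X in _ <= _ <= X](eq_bigr (fun i => f i 1)) // => i _.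
  by congr (f i _); lra.
Qed.

Lemma refinement_sequence (st0 : (I -> R) * (I -> R)) : admissible st0 ->
  exists st : nat -> (I -> R) * (I -> R),
    (forall k, admissible (st k)) /\ (forall k, refines (st k) (st k.+1)).
Proof.
move=> adm0; pose S := {st | admissible st}.
have step (x : S) : {y : S | refines (sval x) (sval y)}.
  apply: cid; case: x => st adm /=.
  by have [st' adm' ref] := refinement_step adm; exists (exist _ st' adm').
have [g [_ gS]] := dependent_choice step (exist _ st0 adm0 : S).
by exists (fun k => sval (g k)); split => // k; exact: svalP (g k).
Qed.

(** Every [T] between the sums of the [f i] at the left ends and at the right ends
    of the right parts is a sum of values at points of the Cantor sets. *)
Lemma right_parts_fill :
  \sum_i f i ((1 + alpha i) / 2) <= T <= \sum_i f i 1 ->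
  exists2 c : I -> R,
    forall i, on_all_levels (alpha i) (c i) & \sum_i f i (c i) = T.
Proof.
move=> /admissible_start /refinement_sequence[st [adm ref]].
have lev i k : on_all_levels (alpha i) ((st k).1 i).
  have [_ lev _ _] := adm k; rewrite -[_.1 i]addr0 -(mulr0 ((st k).2 i)).
  by apply: lev; exact: on_all_levels0.
have inc i : nondecreasing_seq (fun k => (st k).1 i).
  by apply/nondecreasing_seqP => k; have [] := ref k.
have dec i : nonincreasing_seq (fun k => (st k).1 i + (st k).2 i).
  by apply/nonincreasing_seqP => k; have [] := ref k.
have pos i k : 0 < (st k).2 i by have [/(_ i)[]] := adm k.
have le_ends i k j : (st k).1 i <= (st j).1 i + (st j).2 i.
  have [kj|/ltnW jk] := leqP k j.
    by apply: (le_trans (inc i _ _ kj)); rewrite lerDl ltW.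
  by apply: (le_trans _ (dec i _ _ jk)); rewrite lerDl ltW.
(* The point to be found is the limit of the left ends. *)
pose c i := sup (range (fun k => (st k).1 i)).
have ubd i : has_ubound (range (fun k => (st k).1 i)).
  by exists ((st 0%N).1 i + (st 0%N).2 i) => _ [k _ <-].
have uc i k : (st k).1 i <= c i by apply: (ub_le_sup (ubd i)); exists k.
have cv i k : c i <= (st k).1 i + (st k).2 i.
  apply: ge_sup; first by exists ((st 0%N).1 i), 0%N.
  by move=> _ [j _ <-].
exists c => [i|].
  apply: (on_all_levels_limit (lev i)).
  by apply: nondecreasing_cvgn => //; exact: inc.
pose L k := \sum_i (st k).2 i.
pose q : R := 1 - (2 * #|I|%:R)^-1.
have close k : `|T - \sum_i f i (c i)| <= L k.
  have [us _ _ /andP[loT Thi]] := adm k.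
  have fu_fc : \sum_i f i ((st k).1 i) <= \sum_i f i (c i).
    apply: ler_sum => i _; have [ui si usi] := us i.
    have /andP[le_f _] := f_slope ui (uc i k) (le_trans (cv i k) usi).
    have /andP[wi0 _] := w01 i.
    rewrite -subr_ge0; apply: le_trans le_f; rewrite mulr_ge0 // subr_ge0.
    exact: uc.
  have fc : \sum_i f i (c i) <= \sum_i f i ((st k).1 i) + L k.
    rewrite -big_split /=; apply: ler_sum => i _; have [ui si usi] := us i.
    have /andP[_ f_le] := f_slope ui (uc i k) (le_trans (cv i k) usi).
    by have := cv i k; lra.
  have fv : \sum_i f i ((st k).1 i + (st k).2 i)
      <= \sum_i f i ((st k).1 i) + L k.
    rewrite -big_split /=; apply: ler_sum => i _; have [ui si usi] := us i.
    have uv : (st k).1 i <= (st k).1 i + (st k).2 i by lra.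
    by have /andP[_ f_le] := f_slope ui uv usi; lra.
  by rewrite ler_norml; apply/andP; split; lra.
have L0 : 0 <= L 0%N by apply: sumr_ge0 => i _; exact: ltW.
have [i0 _|I0] := pickP (fun _ : I => true); last first.
  by have := wide; rewrite big_pred0 ?ltr10 // => i; rewrite -(I0 i).
have card1 : 1 <= #|I|%:R :> R by rewrite ler1n; apply/card_gt0P; exists i0.
have inv0 : 0 < (2 * #|I|%:R)^-1 :> R by rewrite invr_gt0; lra.
have inv1 : (2 * #|I|%:R)^-1 <= 1 :> R by rewrite invf_le1; lra.
have q0 : 0 <= q by rewrite /q; lra.
have q1 : `|q| < 1 by rewrite ger0_norm // /q; lra.
have decay k : L k <= geometric (L 0%N) q k.
  elim: k => [|k IH]; first by rewrite /geometric /= expr0 mulr1.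
  have [_ _ Lk] := ref k; apply: (le_trans Lk).
  rewrite /geometric /= exprS mulrCA; exact: ler_wpM2l.
have lim0 := cvg_geometric (L 0%N) q1.
have : `|T - \sum_i f i (c i)| <= 0.
  rewrite -[leRHS](cvg_lim _ lim0) //; apply: limr_ge; first exact: cvgP lim0.
  by apply: nearW => k; exact: le_trans (close k) (decay k).
by rewrite normr_le0 subr_eq0 => /eqP.
Qed.

End refinement.

(** * Sums of powers *)

Lemma exprn_slope (R : realType) (m : nat) (a x y : R) : (1 <= m)%N ->
  0 <= a -> a <= x -> x <= y -> y <= 1 ->
  a ^+ (m - 1) * (y - x) <= (y ^+ m - x ^+ m) / m%:R <= y - x.
Proof.
move=> m1 a0 ax xy y1.
have m0 : 0 < m%:R :> R by rewrite ltr0n.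
have x0 : 0 <= x by lra.
have y0 : 0 <= y by lra.
have yx : 0 <= y - x by lra.
rewrite subrXX; set S := \sum_(i < m) _.
have S_ge : a ^+ (m - 1) * m%:R <= S.
  rewrite mulr_natr -[X in _ *+ X]card_ord -sumr_const; apply: ler_sum => i _.
  have -> : (m - 1 = m.-1 - i + i)%N by have := ltn_ord i; lia.
  by rewrite exprD ler_pM ?exprn_ge0 // lerXn2r ?nnegrE //; lra.
have S_le : S <= m%:R.
  rewrite -[m in m%:R]card_ord -sumr_const; apply: ler_sum => i _.
  by rewrite mulr_ile1 ?exprn_ge0 ?exprn_ile1 //; lra.
rewrite ler_pdivlMr // ler_pdivrMr //; apply/andP; split.
  by rewrite mulrAC mulrC; exact: ler_wpM2l.
exact: ler_wpM2l.
Qed.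

Lemma right_power_sums_fill (R : realType) (I : finType) (m : nat)
    (alpha : I -> R) (T : R) : (1 <= m)%N -> (forall i, 0 < alpha i < 1) ->
  1 < \sum_i ((1 + alpha i) / 2) ^+ (m - 1) * ((1 - alpha i) / 2) ->
  \sum_i ((1 + alpha i) / 2) ^+ m <= T <= #|I|%:R ->
  exists2 c : I -> R,
    forall i, central_cantor (alpha i) (c i) & \sum_i c i ^+ m = T.
Proof.
move=> m1 alpha01 wide /andP[loT Thi].
have m0 : 0 < m%:R :> R by rewrite ltr0n.
have w01 i : 0 <= ((1 + alpha i) / 2) ^+ (m - 1) <= 1.
  have /andP[ai0 ai1] := alpha01 i.
  by rewrite exprn_ge0 ?exprn_ile1 //; lra.
have slope i x y : (1 + alpha i) / 2 <= x -> x <= y -> y <= 1 ->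
    ((1 + alpha i) / 2) ^+ (m - 1) * (y - x)
    <= y ^+ m / m%:R - x ^+ m / m%:R <= y - x.
  have /andP[ai0 ai1] := alpha01 i => ax xy y1.
  by rewrite -mulrBl; apply: exprn_slope => //; lra.
have [|c clev csum] := @right_parts_fill R I alpha _
    (fun _ x => x ^+ m / m%:R) (T / m%:R) alpha01 w01 slope wide.
  rewrite -!mulr_suml !ler_pM2r ?invr_gt0 // loT.
  by rewrite expr1n sumr_const.
exists c => [i|]; first exact: on_all_levels_cantor.
move: csum; rewrite -mulr_suml; apply: mulIf.
by rewrite invr_eq0 gt_eqF.
Qed.

Lemma right_power_sums_length (R : realType) (I : finType) (m : nat)
    (alpha : I -> R) : (1 <= m)%N -> (forall i, 0 < alpha i < 1) ->
  1 < \sum_i ((1 + alpha i) / 2) ^+ (m - 1) * ((1 - alpha i) / 2) ->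
  \sum_i ((1 + alpha i) / 2) ^+ m + m%:R <= #|I|%:R.
Proof.
move=> m1 alpha01 wide.
have m0 : 0 < m%:R :> R by rewrite ltr0n.
rewrite addrC -lerBrDr -sumr_const -sumrB.
apply: (@le_trans _ _
  (m%:R * \sum_i ((1 + alpha i) / 2) ^+ (m - 1) * ((1 - alpha i) / 2))).
  by rewrite ler_peMr // ltW.
rewrite mulr_sumr; apply: ler_sum => i _; have /andP[ai0 ai1] := alpha01 i.
have a_ge0 : 0 <= (1 + alpha i) / 2 by lra.
have a_le1 : (1 + alpha i) / 2 <= 1 by lra.
have /andP[+ _] := exprn_slope m1 a_ge0 (lexx _) a_le1 (lexx _).
rewrite ler_pdivlMr // expr1n => le_f; rewrite mulrC; apply: le_trans le_f.
by rewrite ler_pM2r //; apply: ler_wpM2l; [rewrite exprn_ge0; lra|lra].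
Qed.

Theorem theorem4 (R : realType) (m n p n1 n2 r1 r2 : nat) (alpha beta : nat -> R)
  (hm : (1 <= m)%N) (hn : (1 <= n)%N) (hp : (1 <= p)%N)
  (hn12 : n = (n1 + n2)%N) (hr12 : p = (r1 + r2)%N)
  (halpha : forall i, (1 <= i <= n)%N -> 0 < alpha i < 1)
  (hbeta : forall i, (1 <= i <= p)%N -> 0 < beta i < 1)
  (halpha_dec : forall i j, (1 <= i)%N -> (i <= j)%N -> (j <= n)%N ->
     alpha j <= alpha i)
  (hbeta_dec : forall i j, (1 <= i)%N -> (i <= j)%N -> (j <= p)%N ->
     beta j <= beta i)
  (hab : alpha 1%N = beta 1%N)
  (hb1 : \sum_(1 <= j < r1.+1)
           ((1 + beta j) / 2) ^+ (m - 1) * ((1 - beta j) / 2) ^+ 2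
         > (3 * beta 1%N - 1) / (1 + beta 1%N))
  (hb2 : \sum_(r1.+1 <= j < (r1 + r2).+1)
           ((1 + beta j) / 2) ^+ (m - 1) * ((1 - beta j) / 2) > 1)
  (ha1 : \sum_(1 <= j < n1.+1)
           ((1 + alpha j) / 2) ^+ (m - 1) * ((1 - alpha j) / 2) ^+ 2
         > (3 * alpha 1%N - 1) / (1 + alpha 1%N))
  (ha2 : \sum_(n1.+1 <= j < (n1 + n2).+1)
           ((1 + alpha j) / 2) ^+ (m - 1) * ((1 - alpha j) / 2) > 1) :
  `[\sum_(2 <= i < n.+1) ((1 + alpha i) / 2) ^+ m + p%:R - 1
      + 2 * ((1 + beta 1%N) / 2) ^+ m,
    \sum_(2 <= i < n.+1) ((1 + alpha i) / 2) ^+ m + (p%:R + 1)]%classic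
  `<=` cantor_power_sums m n p alpha beta.
Proof.
move=> t; rewrite /= in_itv /= => /andP[lot thi].
have m0 : 0 < m%:R :> R by rewrite ltr0n.
pose A i := (1 + alpha i) / 2.
pose al (i : 'I_n2) := alpha (i + n1.+1)%N.
have big_shift (F : nat -> R) :
    \sum_(n1.+1 <= j < n.+1) F j = \sum_(i < n2) F (i + n1.+1)%N.
  by rewrite -{1}[n1.+1]add0n big_addn hn12 -addSn addKn big_mkord.
have al01 i : 0 < al i < 1.
  by apply: halpha; have := ltn_ord i; lia.
have wide : 1 < \sum_i ((1 + al i) / 2) ^+ (m - 1) * ((1 - al i) / 2).
  by move: ha2; rewrite -hn12 big_shift.
have len := right_power_sums_length hm al01 wide.
have a1_01 := halpha 1%N (introT andP (conj (leqnn 1) hn)).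
have /andP[a10 a11] := a1_01.
have sumA : \sum_(1 <= i < n.+1) A i ^+ m
    = \sum_(1 <= i < n1.+1) A i ^+ m + \sum_i ((1 + al i) / 2) ^+ m.
  by rewrite (@big_cat_nat _ _ _ n1.+1) ?big_shift // hn12 ltnS leq_addr.
have sumA1 : \sum_(1 <= i < n.+1) A i ^+ m
    = A 1%N ^+ m + \sum_(2 <= i < n.+1) A i ^+ m.
  by rewrite big_ltn.
(* The target interval is no longer than the one that the c_i, i > n1, fill:
   its length is 2 * (1 - A 1 ^ m) <= 2 * m * (1 - A 1) = m * (1 - alpha 1). *)
have A1m : 2 * (1 - A 1%N ^+ m) <= m%:R.
  have A_ge0 : 0 <= A 1%N by rewrite /A; lra.
  have A_le1 : A 1%N <= 1 by rewrite /A; lra.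
  have /andP[_] := exprn_slope hm A_ge0 (lexx _) A_le1 (lexx _).
  rewrite ler_pdivrMr // expr1n => le_f.
  have : (1 - A 1%N) * m%:R <= 2^-1 * m%:R.
    by rewrite ler_pM2r // /A; lra.
  by lra.
(* What remains for the c_i with i > n1, once all other points are fixed. *)
pose T := t - \sum_(1 <= i < n1.+1) A i ^+ m - A 1%N ^+ m - (p%:R - 1).
have T_in : \sum_i ((1 + al i) / 2) ^+ m <= T <= #|'I_n2|%:R.
  by rewrite -hab -/(A 1%N) in lot; rewrite /T; apply/andP; split; lra.
have [c cC csum] := right_power_sums_fill hm al01 wide T_in.
exists (fun i => if (i <= n1)%N then A i
                 else oapp c 0 (insub (i - n1.+1)%N)),
       (fun i => if i == 1%N then A 1%N else 1).
have cE (i : 'I_n2) :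
    (if (i + n1.+1 <= n1)%N then A (i + n1.+1)%N
     else oapp c 0 (insub (i + n1.+1 - n1.+1)%N)) = c i.
  by rewrite leqNgt addnS ltnS leq_addl /= -addnS addnK valK.
split.
- move=> i /andP[i1 i_n]; case: leqP => [_|n1i].
    by apply: half_add_cantor; apply: halpha; rewrite i1.
  have lt_i : (i - n1.+1 < n2)%N.
    by rewrite ltn_subLR // addSn ltnS -hn12.
  rewrite insubT /=; have := cC (Ordinal lt_i).
  by rewrite /al /= subnK.
- move=> i i_p; have [->|_] := eqVneq i 1%N.
    by rewrite -hab; apply: half_add_cantor.
  by apply: on_all_levels_cantor; apply: on_all_levels1; apply: hbeta.
- rewrite (@big_cat_nat _ _ _ n1.+1) //=; last by rewrite hn12 ltnS leq_addr.
  rewrite big_shift (eq_bigr (fun i => c i ^+ m)); last first.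
    by move=> i _; rewrite cE.
  rewrite csum (eq_big_nat _ _ (F2 := fun i => A i ^+ m)); last first.
    by move=> i /andP[_ i_n1]; rewrite ifT.
  rewrite [X in _ + X]big_ltn //=
    [X in _ + (_ + X)](eq_big_nat _ _ (F2 := fun=> 1)); last first.
    by case=> [|[|i]] //= _; rewrite expr1n.
  rewrite sumr_const_nat subSS natrB // /T; lra.
Qed.
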